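(* Let $(X,Y)$ be a random vector with absolutely continuous distribution. Then $$\mathsf{GMD}(X,Y)=2\left[\mathsf{E}(X)-\mathsf{E}(Y)\right]\left[\tfrac12-\mathsf{Pr}(Y>X)\right]-2\,\mathsf{Cov}(X,\gamma_1(X))-2\,\mathsf{Cov}(Y,\gamma_2(Y)).$$
   Context: Standing assumptions: $X$ and $Y$ are nonnegative random variables, possibly dependent, with $0<\mathsf{E}(X)<\infty$ and $0<\mathsf{E}(Y)<\infty$. The bivariate Gini's mean difference is $\mathsf{GMD}(X,Y)=\mathsf{E}|X-Y|$. The functions $\gamma_1,\gamma_2$ are the conditional probabilities $\gamma_1(t)=\mathsf{Pr}(Y>t\mid X=t)$ and $\gamma_2(t)=\mathsf{Pr}(X>t\mid Y=t)$, $t\ge 0$ (where, for $(X,Y)$ with a joint density, the conditional distributions are those given by the conditional densities). $\mathsf{Cov}$ denotes covariance. *)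

(* Defs.v *)
From HB Require Import structures.
From mathcomp Require Import all_boot all_order all_algebra.
From mathcomp Require Import all_classical all_reals all_analysis.

Set Implicit Arguments.
Unset Strict Implicit.
Unset Printing Implicit Defensive.

Import Order.TTheory GRing.Theory Num.Theory.
Import numFieldNormedType.Exports.

Local Open Scope classical_set_scope.
Local Open Scope ring_scope.

(* The law of (X, Y) is absolutely continuous with respect to the Lebesgue
   measure of the plane, with density f. *)
Definition joint_pdf (d : measure_display) (T : measurableType d)
    (R : realType) (P : probability T R) (X Y : T -> R) (f : R * R -> R) : Prop :=
  [/\ measurable_fun setT f,
      (forall z, 0 <= f z) &
      forall A : set (R * R), measurable A ->
        P [set w | A (X w, Y w)] =
        (\int[(@lebesgue_measure R \x @lebesgue_measure R)%E]_(z in A)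
           (f z)%:E)%E].

Definition marginal_pdf1 (R : realType) (f : R * R -> R) (x : R) : R :=
  \int[@lebesgue_measure R]_y f (x, y).

Definition marginal_pdf2 (R : realType) (f : R * R -> R) (y : R) : R :=
  \int[@lebesgue_measure R]_x f (x, y).

(* Density of Y at y given X = x.  It is 0 when the marginal density at x
   is 0 or infinite, which happens only for x in a null set of the law of X. *)
Definition cond_pdf2 (R : realType) (f : R * R -> R) (x y : R) : R :=
  f (x, y) / marginal_pdf1 f x.

(* Density of X at x given Y = y. *)
Definition cond_pdf1 (R : realType) (f : R * R -> R) (y x : R) : R :=
  f (x, y) / marginal_pdf2 f y.

(* Pr(Y > t | X = t) *)
Definition gamma1 (R : realType) (f : R * R -> R) (t : R) : R :=
  \int[@lebesgue_measure R]_(y in `]t, +oo[) cond_pdf2 f t y.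

(* Pr(X > t | Y = t) *)
Definition gamma2 (R : realType) (f : R * R -> R) (t : R) : R :=
  \int[@lebesgue_measure R]_(x in `]t, +oo[) cond_pdf1 f t x.

Definition GMD (d : measure_display) (T : measurableType d)
    (R : realType) (P : probability T R) (X Y : T -> R) : \bar R :=
  ('E_P[fun w => `|X w - Y w|%R])%E.

(* Main.v *)
Require Import Defs.
From HB Require Import structures.
From mathcomp Require Import all_boot all_order all_algebra.
From mathcomp Require Import all_classical all_reals all_analysis.
From mathcomp Require Import measurable_realfun ring lra.

Import Order.TTheory GRing.Theory Num.Theory.
Import numFieldNormedType.Exports.

Local Open Scope classical_set_scope.
Local Open Scope ring_scope.
Local Open Scope ereal_scope.

(** Write [I] for the indicator of [X < Y] and [J] for that of [Y < X].  Away
    from the diagonal, [|X - Y| = X + Y - 2 X I - 2 Y J], and a law with a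
    density does not charge the diagonal, so that
      [GMD(X, Y) = E X + E Y - 2 E (X I) - 2 E (Y J)].
    The number [gamma1 t] is the conditional probability of [Y > t] given
    [X = t], hence the tower property gives [E (X gamma1(X)) = E (X I)] and
    [E (gamma1(X)) = P (X < Y)], that is
      [Cov (X, gamma1(X)) = E (X I) - E X * P (X < Y)];
    symmetrically [Cov (Y, gamma2(Y)) = E (Y J) - E Y * P (Y < X)], where
    [P (Y < X) = 1 - P (X < Y)].  Substituting [E (X I)] and [E (Y J)] in the
    first formula yields the theorem.

    The tower property [integral_gamma1] is the analytic core.  Expectations
    of functions of [(X, Y)] are iterated integrals against [f]
    ([ge0_integral_joint_pdf]); in the inner integral over [y], the factor
    [gamma1 x] multiplies the marginal density [\int f (x, y) dy], and
    [gamma1] is exactly the ratio that turns this marginal into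
    [\int_(y > x) f (x, y) dy] ([gamma1_emarginal]).  The ratio is meaningful
    only where the marginal is finite, which is almost everywhere because [f]
    has total mass 1 ([ae_emarginal_fin_num]).  The statement for [Y] and
    [gamma2] is the one for [X] and [gamma1] applied to the swapped density
    ([joint_pdf_swap]). *)

(** * Measurable comparisons *)

Section comparison.
Set Implicit Arguments.
Unset Strict Implicit.
Context d (T : measurableType d) (R : realType).
Implicit Types u v : T -> R.

Lemma measurable_set_ltr u v : measurable_fun setT u -> measurable_fun setT v ->
  measurable [set w | (u w < v w)%R].
Proof.
move=> mu mv; have : measurable_fun setT (fun w => (u w < v w)%R).
  exact: measurable_fun_ltr.
by move=> /(_ measurableT [set true]); rewrite setTI; exact.
Qed.

Lemma measurable_set_eqr u v : measurable_fun setT u -> measurable_fun setT v ->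
  measurable [set w | u w = v w].
Proof.
move=> mu mv; have : measurable_fun setT (fun w => (u w == v w)%R).
  exact: measurable_fun_eqr.
move=> /(_ measurableT [set true]); rewrite setTI => /(_ I).
by congr measurable; apply/seteqP; split=> w /= /eqP.
Qed.

Lemma indic_lt u v w :
  \1_[set w | (u w < v w)%R] w = (u w < v w)%R%:R :> R.
Proof. by rewrite indicE mem_setE. Qed.

End comparison.

(** * Integration against a measure with a density *)

Section density.
Set Implicit Arguments.
Unset Strict Implicit.
Context d (T : measurableType d) (R : realType).
Variables (mu nu : {measure set T -> \bar R}) (f : T -> R).
Hypotheses (mf : measurable_fun setT f) (f0 : forall x, (0 <= f x)%R).
Hypothesis nuE : forall A, measurable A -> nu A = \int[mu]_(x in A) (f x)%:E.

Import HBNNSimple.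

(** The defining property of the density, extended by linearity from
    indicators to simple functions. *)
Lemma integral_density_nnsfun (h : {nnsfun T >-> R}) :
  \int[nu]_x (h x)%:E = \int[mu]_x ((h x)%:E * (f x)%:E).
Proof.
have mind (r : R) :
    measurable_fun setT (fun x => (r * \1_(h @^-1` [set r]) x)%:E).
  by apply/measurable_EFinP; exact: measurable_funM.
have mEf : measurable_fun setT (EFin \o f) by exact/measurable_EFinP.
under eq_integral do rewrite fimfunE -fsumEFin//.
under [RHS]eq_integral.
  move=> x _; rewrite fimfunE -fsumEFin// ge0_mule_fsuml; last first.
    by move=> y; exact: nnfun_muleindic_ge0.
  over.
rewrite !ge0_integral_fsum//; last 3 first.
- by move=> r; exact: emeasurable_funM.
- move=> r x _; apply: mule_ge0; last by rewrite lee_fin.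
  exact: nnfun_muleindic_ge0.
- by move=> r x _; exact: nnfun_muleindic_ge0.
apply: eq_fsbigr => r; rewrite inE => -[t _ tr].
have r0 : (0 <= r)%R by rewrite -tr.
rewrite integralZl_indic_nnsfun// integral_indic// setIT nuE//.
under [RHS]eq_integral do rewrite EFinM -muleA.
rewrite ge0_integralZl//; last 2 first.
- by apply: emeasurable_funM => //; exact/measurable_EFinP.
- by move=> x _; rewrite mule_ge0 ?lee_fin.
congr (_ * _); rewrite integral_mkcond; apply: eq_integral => x _.
by rewrite muleC epatch_indic.
Qed.

(** Both sides pass to the limit along an increasing sequence of simple
    functions, by monotone convergence. *)
Lemma ge0_integral_density (g : T -> \bar R) :
    measurable_fun setT g -> (forall x, 0 <= g x) ->
  \int[nu]_x g x = \int[mu]_x (g x * (f x)%:E).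
Proof.
move=> mg g0; pose h := nnsfun_approx measurableT mg.
have hg x : (EFin \o h n) x @[n --> \oo] --> g x by exact: cvg_nnsfun_approx.
have nd x : {homo (fun n => (h n x)%:E) : m n / (m <= n)%N >-> m <= n}.
  by move=> m n mn; rewrite lee_fin; exact/lefP/nd_nnsfun_approx.
transitivity (limn (fun n => \int[nu]_x (h n x)%:E)).
  rewrite -monotone_convergence//.
  - by apply: eq_integral => x _; apply/esym/cvg_lim => //; exact: hg.
  - by move=> n; exact/measurable_EFinP.
  - by move=> n x _; rewrite lee_fin.
under eq_fun do rewrite integral_density_nnsfun.
rewrite -monotone_convergence//.
- apply: eq_integral => x _; apply/cvg_lim => //.
  by apply: cvgeZr => //; exact: hg.
- by move=> n; apply: emeasurable_funM; exact/measurable_EFinP.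
- by move=> n x _; rewrite mule_ge0 ?lee_fin.
- by move=> x _ m n mn; rewrite lee_wpmul2r ?lee_fin//; exact: nd.
Qed.

End density.

(** * The marginal density and the conditional tail probability *)

Section conditional_tail.
Set Implicit Arguments.
Unset Strict Implicit.
Context (R : realType) (f : R * R -> R).
Local Notation mu := (@lebesgue_measure R).
(* The measurable structure on the reals for which [lebesgue_measure] is
   registered as a measure. *)
Local Notation RT := (measurableTypeR R).
Hypotheses (mf : measurable_fun setT (f : RT * RT -> R)).
Hypothesis f0 : forall z, (0 <= f z)%R.

Let mEf : measurable_fun setT (EFin \o f : RT * RT -> \bar R).
Proof. exact/measurable_EFinP. Qed.

(** The marginal density of the first coordinate before truncation to a real
    number: it keeps the value [+oo] that [marginal_pdf1] sends to [0]. *)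
Definition emarginal (x : RT) : \bar R := \int[mu]_y (f (x, y))%:E.

Definition emarginal_above (x : RT) : \bar R :=
  \int[mu]_(y in `]x, +oo[) (f (x, y))%:E.

Let mfx (x : RT) : measurable_fun setT (fun y : RT => (f (x, y))%:E).
Proof. exact: measurable_fun_pair2 mEf. Qed.

Let emarginal_ge0 x : 0 <= emarginal x.
Proof. by apply: integral_ge0 => y _; rewrite lee_fin. Qed.

Let emarginal_above_ge0 x : 0 <= emarginal_above x.
Proof. by apply: integral_ge0 => y _; rewrite lee_fin. Qed.

Let emarginal_above_le x : emarginal_above x <= emarginal x.
Proof.
apply: ge0_subset_integral => //.
by move=> y _; rewrite lee_fin.
Qed.

Let emarginal_fine_neq0 x : fine (emarginal x) != 0%R ->
  emarginal x \is a fin_num.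
Proof.
by apply: contraNT; rewrite fin_numE negb_and !negbK => /orP[]/eqP->.
Qed.

Let emarginal_above_fin_num x : emarginal x \is a fin_num ->
  emarginal_above x \is a fin_num.
Proof.
move=> mfin.
by rewrite ge0_fin_numE// (le_lt_trans (emarginal_above_le x))// ltey_eq mfin.
Qed.

Lemma emarginal_aboveE x :
  emarginal_above x = \int[mu]_y ((x < y)%R%:R%:E * (f (x, y))%:E).
Proof.
rewrite /emarginal_above integral_mkcond; apply: eq_integral => y _.
rewrite patchE /= mem_setE in_itv/= andbT.
by case: (x < y)%R; rewrite ?mul1e ?mul0e.
Qed.

Lemma measurable_emarginal : measurable_fun setT emarginal.
Proof.
by apply: (@measurable_fun_fubini_tonelli_F _ _ RT RT R mu (EFin \o f)).
Qed.

Lemma measurable_lt_ind :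
  measurable_fun setT (fun z : RT * RT => (z.1 < z.2)%R%:R%:E : \bar R).
Proof.
apply/measurable_EFinP.
rewrite (_ : (fun _ => _) = \1_[set z : RT * RT | (z.1 < z.2)%R]); last first.
  by apply/funext => z; rewrite indic_lt.
by apply: measurable_indic; exact: measurable_set_ltr.
Qed.

Lemma measurable_emarginal_above : measurable_fun setT emarginal_above.
Proof.
have -> : emarginal_above = fun x =>
    \int[mu]_y ((x < y)%R%:R%:E * (f (x, y))%:E).
  by apply/funext => x; exact: emarginal_aboveE.
apply: (@measurable_fun_fubini_tonelli_F _ _ RT RT R mu
  (fun z => (z.1 < z.2)%R%:R%:E * (f z)%:E)).
  by apply: emeasurable_funM => //; exact: measurable_lt_ind.
by move=> z; rewrite mule_ge0 ?lee_fin.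
Qed.

(** The equality also covers the points where the marginal is null or
    infinite: there the denominator is [0] and both sides vanish. *)
Lemma gamma1E x :
  gamma1 f x = (fine (emarginal_above x) / fine (emarginal x))%R.
Proof.
rewrite /gamma1 /Rintegral /cond_pdf2 /marginal_pdf1 /Rintegral -/(emarginal x).
under eq_integral do rewrite mulrC EFinM.
rewrite ge0_integralZl//; last 3 first.
- exact: measurable_funTS.
- by move=> y _; rewrite lee_fin.
- by rewrite lee_fin invr_ge0 fine_ge0.
rewrite -/(emarginal_above x) mulrC.
have [->|m0] := eqVneq (fine (emarginal x)) 0%R.
  by rewrite invr0 mul0e mul0r.
by rewrite fineM// emarginal_above_fin_num// emarginal_fine_neq0.
Qed.

Lemma measurable_gamma1 : measurable_fun setT (gamma1 f).
Proof.
have -> : gamma1 f = fun x =>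
    (fine (emarginal_above x) / fine (emarginal x))%R.
  by apply/funext => x; exact: gamma1E.
apply: measurable_funM.
  exact: measurableT_comp measurable_emarginal_above.
(* On nonnegative reals the inverse, null at [0], is the power [-1]. *)
under eq_fun do rewrite -powR_inv1 ?fine_ge0//.
apply: (measurableT_comp (measurable_powR _)) => //.
exact: measurableT_comp measurable_emarginal.
Qed.

Lemma gamma1_ge0 x : (0 <= gamma1 f x)%R.
Proof. by rewrite gamma1E divr_ge0 ?fine_ge0. Qed.

Lemma gamma1_le1 x : (gamma1 f x <= 1)%R.
Proof.
rewrite gamma1E.
have [->|m0] := eqVneq (fine (emarginal x)) 0%R; first by rewrite invr0 mulr0.
have mfin := emarginal_fine_neq0 m0.
by rewrite ler_pdivrMr ?mul1r ?lt0r ?m0 ?fine_ge0// fine_le//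
  emarginal_above_fin_num.
Qed.

(** Where the marginal vanishes, so does the smaller integral over [y > x], and
    the identity survives the division by zero. *)
Lemma gamma1_emarginal x : emarginal x \is a fin_num ->
  (gamma1 f x)%:E * emarginal x = emarginal_above x.
Proof.
move=> mfin; rewrite gamma1E.
have tfin := emarginal_above_fin_num mfin.
have [m0|m0] := eqVneq (fine (emarginal x)) 0%R.
  have mE : emarginal x = 0 by rewrite -(fineK mfin) m0.
  rewrite mE mule0; apply/esym/eqP; rewrite eq_le emarginal_above_ge0 andbT.
  by rewrite -mE.
by rewrite -[X in _ * X](fineK mfin) -EFinM divfK// fineK.
Qed.

End conditional_tail.

(** * Expectations of functions of the pair *)

Section joint_pdf.
Set Implicit Arguments.
Unset Strict Implicit.
Context d (T : measurableType d) (R : realType) (P : probability T R).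
Variables (X Y : {RV P >-> R}) (f : R * R -> R).
Hypothesis f_pdf : joint_pdf P X Y f.
Local Notation mu := (@lebesgue_measure R).
Local Notation RT := (measurableTypeR R).

Lemma joint_pdf_measurable : measurable_fun setT (f : RT * RT -> R).
Proof. by case: f_pdf. Qed.
Let mf := joint_pdf_measurable.

Lemma joint_pdf_ge0 z : (0 <= f z)%R.
Proof. by case: f_pdf. Qed.
Let f0 := joint_pdf_ge0.

Let mEf : measurable_fun setT (EFin \o f : RT * RT -> \bar R).
Proof. exact/measurable_EFinP. Qed.

Let mfx (x : RT) : measurable_fun setT (fun y : RT => (f (x, y))%:E).
Proof. exact: measurable_fun_pair2 mEf. Qed.

Let mX : measurable_fun setT (X : T -> RT).
Proof. exact: (@measurable_funPT _ _ _ _ X). Qed.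

Let mY : measurable_fun setT (Y : T -> RT).
Proof. exact: (@measurable_funPT _ _ _ _ Y). Qed.

Lemma ge0_integral_joint_pdf (g : RT * RT -> \bar R) :
    measurable_fun setT g -> (forall z, 0 <= g z) ->
  \int[P]_w g (X w, Y w) = \int[mu]_x \int[mu]_y (g (x, y) * (f (x, y))%:E).
Proof.
move=> mg g0.
have mXY : measurable_fun setT (fun w => (X w, Y w) : RT * RT)%type.
  exact: (measurable_fun_pair mX mY).
pose XY : {RV P >-> (RT * RT)%type} :=
  HB.pack (fun w => (X w, Y w) : RT * RT)%type
    (isMeasurableFun.Build _ _ _ _ _ mXY).
transitivity (\int[distribution P XY]_z g z).
  by rewrite (ge0_integral_distribution XY).
have lawE A : measurable A ->
    distribution P XY A = \int[(mu \x mu)%E]_(z in A) (f z)%:E.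
  by case: f_pdf => _ _; exact.
transitivity (\int[(mu \x mu)%E]_z (g z * (f z)%:E)).
  exact: (ge0_integral_density (mu := (mu \x mu)%E) mf f0 lawE mg g0).
rewrite fubini_tonelli1//; first exact: emeasurable_funM.
by move=> z; rewrite mule_ge0 ?lee_fin.
Qed.

Lemma joint_pdf_swap : joint_pdf P Y X (fun z => f (z.2, z.1)).
Proof.
have msw : measurable_fun setT (fun z : RT * RT => (z.2, z.1)).
  by apply: measurable_fun_pair; [exact: measurable_snd|exact: measurable_fst].
split=> [|z|A mA]; [exact: (measurableT_comp mf msw)|exact: f0|].
have mA' : measurable [set z : RT * RT | A (z.2, z.1)].
  by rewrite -[X in measurable X]setTI; exact: msw.
rewrite (_ : [set w | _] =
  [set w | [set z : RT * RT | A (z.2, z.1)] (X w, Y w)])//.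
case: f_pdf => _ _ ->//.
rewrite integral_mkcond [RHS]integral_mkcond fubini_tonelli1; last 2 first.
- by apply/(measurable_restrictT _ _).1 => //; exact: measurable_funTS.
- by apply: erestrict_ge0 => z _; rewrite lee_fin.
(* The swap exchanges the two orders of integration. *)
rewrite fubini_tonelli2//; last 2 first.
- apply/(measurable_restrictT _ _).1 => //; apply: measurable_funTS.
  exact: (measurableT_comp mEf msw).
- by apply: erestrict_ge0 => z _; rewrite lee_fin.
Qed.

Let emarg_ge0 x : 0 <= emarginal f x.
Proof. by apply: integral_ge0 => y _; rewrite lee_fin. Qed.

(** The marginal has integral [P(setT) = 1]. *)
Lemma ae_emarginal_fin_num : {ae mu, forall x, emarginal f x \is a fin_num}.
Proof.
have : mu.-integrable setT (emarginal f).
  apply/integrableP; split; first exact: (measurable_emarginal mf f0).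
  under eq_integral do rewrite gee0_abs//.
  rewrite (_ : (\int[mu]_x _) = \int[P]_w (cst 1 w)).
    by rewrite integral_cst// mul1e -ge0_fin_numE// fin_num_measure.
  rewrite (ge0_integral_joint_pdf (g := cst 1))//.
  by apply: eq_integral => x _; apply: eq_integral => y _; rewrite mul1e.
by move/integrable_ae => /(_ measurableT); apply: filterS => x /(_ I).
Qed.

(** The tower property [E (u(X) P(Y > X | X)) = E (u(X) 1_{X < Y})]: once [y]
    is integrated out, both sides are the integral of [u] against
    [emarginal_above f]. *)
Lemma integral_gamma1 (u : RT -> R) :
    measurable_fun setT u -> (forall x, (0 <= u x)%R) ->
  \int[P]_w (u (X w) * gamma1 f (X w))%:E =
  \int[P]_w (u (X w) * (X w < Y w)%R%:R)%:E.
Proof.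
move=> mu_ u0.
have mu1 : measurable_fun setT (EFin \o u) by exact/measurable_EFinP.
have mug : measurable_fun setT (fun x => (u x * gamma1 f x)%:E : \bar R).
  apply/measurable_EFinP; apply: measurable_funM => //.
  exact: (measurable_gamma1 mf f0).
have m1 : measurable_fun setT (fun z : RT * RT => (u z.1)%:E : \bar R).
  exact: (measurableT_comp mu1 measurable_fst).
rewrite (ge0_integral_joint_pdf
  (g := fun z => (u z.1 * gamma1 f z.1)%:E)); last 2 first.
- exact: (measurableT_comp mug measurable_fst).
- by move=> z; rewrite lee_fin mulr_ge0// (gamma1_ge0 mf f0).
rewrite (ge0_integral_joint_pdf
  (g := fun z => (u z.1 * (z.1 < z.2)%R%:R)%:E)); last 2 first.
- under eq_fun do rewrite EFinM.
  by apply: emeasurable_funM => //; exact: measurable_lt_ind.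
- by move=> z; rewrite lee_fin mulr_ge0.
transitivity (\int[mu]_x ((u x * gamma1 f x)%:E * emarginal f x)).
  apply: eq_integral => x _ /=; rewrite ge0_integralZl//=.
  - by move=> y _; rewrite lee_fin.
  - by rewrite lee_fin mulr_ge0// (gamma1_ge0 mf f0).
transitivity (\int[mu]_x ((u x)%:E * emarginal_above f x)); last first.
  apply: eq_integral => x _ /=; rewrite emarginal_aboveE.
  under [RHS]eq_integral do rewrite EFinM -muleA.
  rewrite ge0_integralZl//= ?lee_fin//.
  - apply: emeasurable_funM => //.
    exact: (measurable_fun_pair2 x (@measurable_lt_ind R)).
  - by move=> y _; rewrite mule_ge0 ?lee_fin.
apply: ge0_ae_eq_integral => //.
- by apply: emeasurable_funM => //; exact: (measurable_emarginal mf f0).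
- by apply: emeasurable_funM => //; exact: (measurable_emarginal_above mf f0).
- by move=> x _; rewrite mule_ge0// lee_fin mulr_ge0// (gamma1_ge0 mf f0).
- move=> x _; rewrite mule_ge0 ?lee_fin//.
  by apply: integral_ge0 => y _; rewrite lee_fin.
- apply: filterS ae_emarginal_fin_num => x mx _.
  by rewrite EFinM -muleA (gamma1_emarginal mf f0).
Qed.

(** The vertical sections of the diagonal are points, hence Lebesgue null. *)
Lemma joint_pdf_no_tie : P [set w | X w = Y w] = 0.
Proof.
have mD : measurable [set z : RT * RT | z.1 = z.2].
  exact: measurable_set_eqr.
case: (f_pdf) => _ _ /(_ _ mD)/= ->.
rewrite integral_mkcond fubini_tonelli1; last 2 first.
- by apply/(measurable_restrictT _ _).1 => //; exact: measurable_funTS.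
- by apply: erestrict_ge0 => z _; rewrite lee_fin.
rewrite integral0_eq// => x _; rewrite /fubini_F.
rewrite -[RHS](integral_set1 (fun y => (f (x, y))%:E) x) [RHS]integral_mkcond.
apply: eq_integral => y _; rewrite !patchE.
suff -> : ((x, y) \in [set z : RT * RT | z.1 = z.2]) = (y \in [set x]) by [].
by apply/idP/idP; rewrite !inE/=.
Qed.

(** Ties being null, the two strict comparisons share the whole mass. *)
Lemma joint_pdf_probability_gt :
  P [set w | (Y w < X w)%R] = 1 - P [set w | (X w < Y w)%R].
Proof.
rewrite -probability_setC; last exact: measurable_set_ltr.
rewrite (_ : ~` _ = [set w | (Y w < X w)%R] `|` [set w | X w = Y w]).
  rewrite measureU0//; first exact: measurable_set_ltr.
    exact: measurable_set_eqr.
  exact: joint_pdf_no_tie.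
apply/seteqP; split=> w /=.
  by move/negP; rewrite -leNgt le_eqVlt => /orP[/eqP->|?]; [right|left].
by move=> [/ltW|->]; [rewrite leNgt => /negP|rewrite ltxx].
Qed.

End joint_pdf.

(** * Covariances and the mean difference *)

Lemma normB_lt (R : realDomainType) (x y : R) : x != y ->
  (`|x - y| = x + y - (x * (x < y)%R%:R * 2 + y * (y < x)%R%:R * 2))%R.
Proof.
case: ltgtP => // [xy|yx] _; rewrite !(mulr1, mulr0, mul0r).
  by rewrite ltr0_norm ?subr_lt0//; ring.
by rewrite gtr0_norm ?subr_gt0//; ring.
Qed.

Section mean_difference.
Set Implicit Arguments.
Unset Strict Implicit.
Context d (T : measurableType d) (R : realType) (P : probability T R).

Lemma Lfun1_bounded_mul (Z u : T -> R) : Z \in Lfun P 1 ->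
  measurable_fun setT u -> (forall w, (0 <= u w <= 1)%R) ->
  (Z \* u)%R \in Lfun P 1.
Proof.
move=> /Lfun1_integrable iZ mu_ u01; apply/Lfun1_integrable.
have mZ : measurable_fun setT Z
  by apply/measurable_EFinP; exact: measurable_int iZ.
apply: (le_integrable _ _ _ iZ) => //.
  by apply/measurable_EFinP; exact: measurable_funM.
move=> w _ /=; have /andP[u0 u1] := u01 w.
by rewrite lee_fin normrM (ger0_norm u0) ler_piMr.
Qed.

Lemma Lfun1_mul_indic (Z : T -> R) (A : set T) : Z \in Lfun P 1 ->
  measurable A -> (Z \* \1_A)%R \in Lfun P 1.
Proof.
move=> LZ mA; apply: Lfun1_bounded_mul => // w.
by rewrite indicE ler0n lern1 leq_b1.
Qed.

Lemma ge0_Lfun1 (Z : {RV P >-> R}) :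
    (forall w, (0 <= Z w)%R) -> 'E_P[Z] < +oo ->
  (Z : T -> R) \in Lfun P 1.
Proof.
move=> Z0; rewrite unlock => EZ; apply/Lfun1_integrable/integrableP; split.
  exact/measurable_EFinP.
by under eq_integral do rewrite /= ger0_norm//.
Qed.

Variables (X Y : {RV P >-> R}) (f : R * R -> R).
Hypothesis f_pdf : joint_pdf P X Y f.

Lemma covariance_gamma1 : (forall w, (0 <= X w)%R) -> 'E_P[X] < +oo ->
  covariance P X (gamma1 f \o X) =
    'E_P[((X : T -> R) \* \1_[set w | (X w < Y w)%R])%R]
    - 'E_P[X] * P [set w | (X w < Y w)%R].
Proof.
move=> X0 EX.
have mlt : measurable [set w | (X w < Y w)%R] by exact: measurable_set_ltr.
have LX : (X : T -> R) \in Lfun P 1 by exact: ge0_Lfun1.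
have mf := joint_pdf_measurable f_pdf; have f0 := joint_pdf_ge0 f_pdf.
have mg : measurable_fun setT (gamma1 f \o X).
  exact: (measurableT_comp (measurable_gamma1 mf f0) (measurable_funPT X)).
have g01 w : (0 <= (gamma1 f \o X) w <= 1)%R.
  by rewrite /= (gamma1_ge0 mf f0) (gamma1_le1 mf f0).
have Lg : (gamma1 f \o X) \in Lfun P 1.
  have := Lfun1_bounded_mul (Lfun_cst P 1%R 1%R) mg g01.
  rewrite [X in X \in _](_ : _ = gamma1 f \o X)//.
  by apply/funext => w /=; rewrite mul1r.
rewrite covarianceE//; last exact: Lfun1_bounded_mul.
congr (_ - _ * _).
  rewrite unlock.
  (* [X] agrees with its positive part, which is nonnegative as a function on
     the whole line, as the tower property requires. *)
  transitivity (\int[P]_w (Num.max (X w) 0 * gamma1 f (X w))%:E).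
    by apply: eq_integral => w _ /=; rewrite max_l.
  rewrite (integral_gamma1 f_pdf (u := fun x => Num.max x 0%R)).
  - by apply: eq_integral => w _ /=; rewrite indic_lt max_l.
  - exact: measurable_maxr.
  - by move=> x; rewrite le_max lexx orbT.
rewrite -expectation_indic// unlock.
transitivity (\int[P]_w (1 * gamma1 f (X w))%:E).
  by apply: eq_integral => w _; rewrite mul1r.
rewrite (integral_gamma1 f_pdf (u := cst 1%R))//.
by apply: eq_integral => w _; rewrite mul1r indic_lt.
Qed.

(** The pointwise formula for [|X - Y|] fails only on the diagonal, which is
    null. *)
Lemma GMD_joint_pdf : (X : T -> R) \in Lfun P 1 -> (Y : T -> R) \in Lfun P 1 ->
  GMD P X Y = 'E_P[X] + 'E_P[Y]
    - (2%:E * 'E_P[((X : T -> R) \* \1_[set w | (X w < Y w)%R])%R]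
       + 2%:E * 'E_P[((Y : T -> R) \* \1_[set w | (Y w < X w)%R])%R]).
Proof.
move=> LX LY.
set XA := (_ \* \1_[set w | (X w < Y w)%R])%R.
set YB := (_ \* \1_[set w | (Y w < X w)%R])%R.
have LXA : XA \in Lfun P 1.
  by apply: Lfun1_mul_indic => //; exact: measurable_set_ltr.
have LYB : YB \in Lfun P 1.
  by apply: Lfun1_mul_indic => //; exact: measurable_set_ltr.
rewrite -!expectationZl// -!expectationD//; last 2 first.
- exact: Lfun_scale.
- exact: Lfun_scale.
rewrite -expectationB//; last 2 first.
- exact: rpredD.
- by apply: rpredD; exact: Lfun_scale.
have LS : ((X : T -> R) \+ Y \- (2 \o* XA \+ 2 \o* YB))%R \in Lfun P 1.
  by apply: rpredB; apply: rpredD => //; exact: Lfun_scale.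
rewrite /GMD unlock; apply: ae_eq_integral => //.
- apply/measurable_EFinP; apply: measurableT_comp => //.
  exact: measurable_funB.
- by move/Lfun1_integrable/measurable_int : LS.
- exists [set w | X w = Y w]; split.
  + exact: measurable_set_eqr.
  + exact: joint_pdf_no_tie f_pdf.
  + move=> w /= H; apply: contrapT => XY; apply: H => _.
    by congr EFin; rewrite /XA /YB /= !indic_lt normB_lt//; exact/eqP.
Qed.

End mean_difference.

Theorem theorem3p1 (d : measure_display) (T : measurableType d)
    (R : realType) (P : probability T R)
    (X Y : {RV P >-> R})
    (X_ge0 : forall w, (0 <= X w)%R)
    (Y_ge0 : forall w, (0 <= Y w)%R)
    (EX_gt0 : 0 < 'E_P[X]) (EX_lty : 'E_P[X] < +oo)
    (EY_gt0 : 0 < 'E_P[Y]) (EY_lty : 'E_P[Y] < +oo)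
    (f : R * R -> R) (f_pdf : joint_pdf P X Y f) :
  GMD P X Y =
    2%:E * ('E_P[X] - 'E_P[Y]) * ((2^-1)%:E - P [set w | (X w < Y w)%R])
    - 2%:E * covariance P X (gamma1 f \o X)
    - 2%:E * covariance P Y (gamma2 f \o Y).
Proof.
rewrite (covariance_gamma1 f_pdf)//.
(* [gamma2] is [gamma1] for the density of [(Y, X)]. *)
rewrite -[gamma2 f]/(gamma1 (fun z => f (z.2, z.1))).
rewrite (covariance_gamma1 (joint_pdf_swap f_pdf))//.
have LX : (X : T -> R) \in Lfun P 1 by exact: ge0_Lfun1.
have LY : (Y : T -> R) \in Lfun P 1 by exact: ge0_Lfun1.
have mA : measurable [set w | (X w < Y w)%R] by exact: measurable_set_ltr.
have mB : measurable [set w | (Y w < X w)%R] by exact: measurable_set_ltr.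
rewrite (GMD_joint_pdf f_pdf)// (joint_pdf_probability_gt f_pdf).
(* All the quantities are finite, so that the claim is an identity between
   real numbers. *)
have := expectation_fin_num (Lfun1_mul_indic LX mA).
have := expectation_fin_num (Lfun1_mul_indic LY mB).
have := expectation_fin_num LX; have := expectation_fin_num LY.
have : P [set w | (X w < Y w)%R] \is a fin_num by exact: fin_num_measure.
case: (P _) => [p| |]// _; case: 'E_P[Y] => [b| |]// _.
case: 'E_P[X] => [a| |]// _.
case: 'E_P[_] => [v| |]// _; case: 'E_P[_] => [u| |]// _.
rewrite -!(EFinM, EFinD, EFinN); congr EFin.
lra.
Qed.
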